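(* Let $(r_n)_{n\ge 1}$ be a decreasing sequence of positive numbers with $r_n\to 0$ and $r_n<\frac1n$ for all $n$, and let $S=\bigcap_{m=1}^\infty\bigcup_{n=m}^\infty V_n$ be the corresponding uniform $G_\delta$-set. If $|\log r_n|=o(n)$ as $n\to\infty$, then $$\mathrm{Cap}(S)=\mathrm{Cap}([0,1]).$$
   Context: For a compactly supported Borel measure $\mu$ on $\mathbb{C}$, its energy is $I(\mu):=\iint -\log|z-w|\,d\mu(z)\,d\mu(w)$ (possibly $+\infty$). For a bounded Borel set $X\subset\mathbb{C}$, let $\mathcal{P}(X)$ be the set of Borel probability measures supported on $X$ (i.e. $\mu(\mathbb{C}\setminus X)=0$); the logarithmic capacity of $X$ is $\mathrm{Cap}(X):=\exp(-\inf\{I(\mu)\mid \mu\in\mathcal{P}(X)\})$, with $\exp(-\infty)=0$. For the sequence $(r_n)$ set $c_{j,n}=\frac{2j+1}{2n}$, $J_{j,n}=(c_{j,n}-\frac{r_n}{2},\,c_{j,n}+\frac{r_n}{2})$ for $j=0,\dots,n-1$, and $V_n=\bigcup_{j=0}^{n-1}J_{j,n}$. The uniform $G_\delta$-set corresponding to $(r_n)$ is $S:=\bigcap_{m=1}^\infty\bigcup_{n=m}^\infty V_n$. *)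

(* Defs.v *)
From HB Require Import structures.
From mathcomp Require Import all_boot all_order all_algebra.
From mathcomp Require Import complex.
From mathcomp Require Import all_classical all_reals all_analysis.

Set Implicit Arguments.
Unset Strict Implicit.
Unset Printing Implicit Defensive.

Import Order.TTheory GRing.Theory Num.Theory.
Import numFieldNormedType.Exports.

Local Open Scope classical_set_scope.
Local Open Scope ring_scope.

(* The complex plane with its Borel sigma-algebra. *)
Notation borelC R := (g_sigma_algebraType (@open (complex R : numFieldType)^o)).

(* [lne 0 = -oo], so the kernel takes the value [+oo] on the diagonal. *)
Definition log_kernel (R : realType) (z w : complex R) : \bar R :=
  (- lne (ComplexField.Normc.normc (z - w))%:E)%E.

(* Meant for [mu] compactly supported: the kernel is then bounded below on the
   support, and the iterated integral is unambiguous in [\bar R]. *)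
Definition energy (R : realType) (mu : probability (borelC R) R) : \bar R :=
  (\int[mu]_w \int[mu]_z log_kernel z w)%E.

Definition prob_on (R : realType) (X : set (complex R)) :
    set (probability (borelC R) R) :=
  [set mu | mu (~` X) = 0%E].

(* Meant for [X] bounded and Borel. As [expeR -oo = 0], the capacity is [0]
   when every energy is infinite; the same holds for [X] empty, since
   [ereal_inf set0 = +oo]. *)
Definition Cap (R : realType) (X : set (complex R)) : \bar R :=
  expeR (- ereal_inf [set energy mu | mu in prob_on X])%E.

Section UniformGdelta.
Variables (R : realType) (r : nat -> R).

Definition midpt (j n : nat) : R := (2 * j + 1)%N%:R / (2 * n)%N%:R.

Definition J (j n : nat) : set R :=
  `](midpt j n - r n / 2), (midpt j n + r n / 2)[%classic.

Definition V (n : nat) : set R := \bigcup_(j < n) J j n.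

Definition uniform_Gdelta : set R := \bigcap_(m >= 1) \bigcup_(n >= m) V n.

End UniformGdelta.

Definition toC (R : realType) (A : set R) : set (complex R) :=
  [set real_complex R x | x in A].

(* Main.v *)
Require Import Defs.
From HB Require Import structures.
From mathcomp Require Import all_boot all_order all_algebra.
From mathcomp Require Import ring lra.
From mathcomp Require Import complex.
From mathcomp Require Import all_classical all_reals all_analysis measurable_realfun.

Set Implicit Arguments.
Unset Strict Implicit.
Unset Printing Implicit Defensive.

Import Order.TTheory GRing.Theory Num.Theory.
Import numFieldNormedType.Exports.

Local Open Scope classical_set_scope.
Local Open Scope ring_scope.

(** Both sets lie in the unit interval, and [uniform_Gdelta r] is a subset of
    it, so one inequality is monotonicity of the infimum of the energies. For
    the other one, a probability of finite energy on the unit interval has to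
    be moved into the G_delta set at an arbitrarily small cost in energy.

    Measures are represented as laws of random variables [X] on a fixed
    probability space, whose energy [rv_energy P X] is the double integral of
    -log |X z - X w|. Moving mass then means composing [X] with a map, and
    weak limits of measures become pointwise limits of functions.

    The basic move is [squeeze r n]. It contracts each cell
    [j/n, (j+1)/n] affinely, by the factor [ratio r n] = n r_n / 2, onto the
    middle half of the closure of J_{j,n}. No point moves by more than 1/n, so
    at pairs with |x - y| >= A/n, with A large, the kernel hardly changes. At
    the other pairs it grows by at most -log (n r_n / 2), which is
    O(|log r_n|). If [X] satisfies the Frostman condition
    P(|X - c| <= e) <= M e, these pairs have probability at most M A / n, so
    the total cost is O(M A |log r_n| / n), and this tends to 0 because
    |log r_n| = o(n) ([squeeze_energy]).

    Distances shrink by a bounded factor under [squeeze r n], hence the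
    Frostman condition survives with a larger constant ([frostman_expand])
    and the move can be repeated with indices n_1 << n_2 << ... growing so fast
    that all later moves together displace a point by less than the margin that
    the middle halves leave in V_{n_k}. The uniform limit lies in every V_{n_k},
    hence in the G_delta set, and by Fatou its energy does not exceed the bound
    common to all stages ([exists_Gdelta_variable]).

    A variable of finite energy need not satisfy a Frostman condition to begin
    with. This is repaired by replacing [X] with a uniformly distributed point
    of the cell of [X], for a fine subdivision ([smooth_energy]). Again only
    pairs at distance O(1/n) matter. There the smoothed energy is
    log n + O(1), whereas the original kernel is at least log n - O(1), so the
    cost is a small multiple of the original energy. *)

(** * Truncated logarithmic kernel *)

Section LogKernel.
Variable R : realType.
Implicit Types d x y c s : R.

(** The maximum with 0 changes nothing on the unit interval, where the
    integrals are taken, and it puts Tonelli and Fatou at one's disposal on the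
    whole line. *)
Definition pos_log d : \bar R := (maxe 0 (- lne `|d|%:E))%E.

Lemma pos_log_ge0 d : (0 <= pos_log d)%E.
Proof. by rewrite /pos_log le_max lexx. Qed.

Lemma pos_log0 : pos_log 0 = +oo%E.
Proof. by rewrite /pos_log normr0 le0_lneNy//= maxey. Qed.

Lemma pos_log_neq0 d : d != 0 -> pos_log d = (Num.max 0 (- ln `|d|))%:E.
Proof. by move=> d0; rewrite /pos_log lne_EFin ?normr_gt0// -EFinN -EFin_max. Qed.

Lemma measurable_lne : measurable_fun setT (fun x : R => lne x%:E).
Proof.
rewrite (_ : (fun x : R => _) = fun x : R => if x <= 0 then -oo%E else (ln x)%:E) //.
apply: measurable_fun_ifT => //.
- exact: measurable_fun_ler.
- exact/measurable_EFinP.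
Qed.

Lemma measurable_pos_log : measurable_fun [set: R] pos_log.
Proof.
apply: measurable_maxe => //; apply: measurableT_comp => //.
exact: (measurableT_comp measurable_lne).
Qed.

(** All comparisons of the kernel at two pairs of points come from this one: a
    contraction by the factor exp c costs at most c. The diagonal needs no separate treatment,
    since the right-hand side is then infinite. *)
Lemma le_pos_log d d' c : 0 <= c -> `|d| <= expR c * `|d'| ->
  (pos_log d' <= pos_log d + c%:E)%E.
Proof.
move=> c0 dd'.
have [->|d0] := eqVneq d 0; first by rewrite pos_log0 addye// leey.
have d'0 : d' != 0.
  by apply: contraNneq d0 => d'0; move: dd'; rewrite d'0 normr0 mulr0 normr_le0.
rewrite !pos_log_neq0// -EFinD lee_fin.
have : ln `|d| <= c + ln `|d'|.
  rewrite -{1}(expRK c) -lnM ?posrE ?expR_gt0 ?normr_gt0//.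
  by rewrite ler_ln// posrE ?normr_gt0// mulr_gt0 ?expR_gt0 ?normr_gt0.
rewrite ge_max; move=> h; apply/andP; split.
  by rewrite addr_ge0// le_max lexx.
have : - ln `|d| <= Num.max 0 (- ln `|d|) by rewrite le_max lexx orbT.
lra.
Qed.

Lemma ln_le_pos_log d s : 0 < s -> `|d| <= s -> ((- ln s)%:E <= pos_log d)%E.
Proof.
move=> s0 ds; have [->|d0] := eqVneq d 0; first by rewrite pos_log0 leey.
rewrite pos_log_neq0// lee_fin le_max; apply/orP; right.
by rewrite lerN2 ler_ln ?posrE ?normr_gt0.
Qed.

(** Each halving of the distance raises the kernel by ln 2, so the kernel is
    controlled by counting the dyadic scales that exceed |x|. Integrated term by
    term against a Frostman measure, this bounds the potential without any
    explicit integral of the logarithm. *)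
Lemma pos_log_dyadic (x : R) : (pos_log x <=
  \sum_(k <oo) (ln 2 * \1_[set y : R | (`|y| <= 1 / (2 ^ k)%:R)%R] x)%:E)%E.
Proof.
pose u k : \bar R := (ln (2 : R) * \1_[set y : R | (`|y| <= 1 / (2 ^ k)%:R)%R] x)%:E.
rewrite -[X in (_ <= X)%E]/(\sum_(k <oo) u k)%E.
have l2 : 0 <= ln 2 :> R by apply: ln_ge0; lra.
have u0 k : (0 <= u k)%E by rewrite lee_fin mulr_ge0.
(* one halving per step, with the kernel at scale 2^n x as remainder *)
have step n : (pos_log x <= \sum_(0 <= k < n) u k + pos_log ((2 ^ n)%:R * x))%E.
  elim: n => [|n ih]; first by rewrite big_geq// add0e expn0 mul1r.
  apply: (le_trans ih); rewrite big_nat_recr//= -addeA leeD2l//.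
  have [h|h] := leP `|x| (1 / (2 ^ n)%:R).
    rewrite /u indicE mem_set//= mulr1 addeC; apply: le_pos_log => //.
    by rewrite lnK ?posrE// expnS natrM -mulrA (normrM 2) ger0_norm.
  have xn : 1 <= `|(2 ^ n)%:R * x|.
    rewrite normrM ger0_norm// mulrC -ler_pdivrMr ?ltr0n ?expn_gt0//.
    exact: ltW.
  apply: (@le_trans _ _ 0%E); last by rewrite adde_ge0 ?u0 ?pos_log_ge0.
  rewrite pos_log_neq0; last by rewrite -normr_gt0; lra.
  by rewrite lee_fin ge_max lexx /= oppr_le0 ln_ge0.
have partial n : (\sum_(0 <= k < n) u k <= \sum_(k <oo) u k)%E.
  by apply: nneseries_lim_ge.
have [x0|x0] := eqVneq x 0.
  rewrite (_ : (\sum_(k <oo) u k)%E = +oo%E) ?leey//.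
  (* at x = 0 every indicator equals 1, so the partial sums are unbounded *)
  apply/eqyP => B B0; pose n := (Num.truncn (B / ln 2)).+1.
  have l2' : 0 < ln 2 :> R by apply: ln_gt0; lra.
  apply: le_trans (partial n).
  rewrite (eq_bigr (fun=> (ln 2)%:E)); last first.
    move=> i _; rewrite /u indicE mem_set ?mulr1//= x0 normr0.
    by rewrite divr_ge0.
  rewrite sumEFin sumr_const_nat subn0 lee_fin -[ln 2 *+ n]mulr_natr.
  by rewrite mulrC -ler_pdivrMr// ltW// truncnS_gt.
pose n := (Num.truncn (1 / `|x|)).+1.
apply: (le_trans (step n)).
suff -> : pos_log ((2 ^ n)%:R * x) = 0%E by rewrite adde0.
have xn : 1 <= `|(2 ^ n)%:R * x|.
  rewrite normrM ger0_norm// -ler_pdivrMr ?normr_gt0//.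
  apply: (@le_trans _ _ n%:R); first by rewrite ltW// truncnS_gt.
  by rewrite ler_nat ltnW// ltn_expl.
rewrite pos_log_neq0; last by rewrite -normr_gt0; lra.
by congr EFin; apply/max_idPl; rewrite oppr_le0 ln_ge0.
Qed.

(** A displacement by e of both points is relatively negligible once their
    distance is at least A e: it loses 2 e <= (2 / A) |x - y|, and the hypothesis
    on A says that 2 / A <= 1 - exp (- s). *)
Lemma dist_le_perturbed (x y x' y' e A s : R) : 0 <= e -> 0 < A -> 0 <= s ->
  2 <= A * (1 - expR (- s)) ->
  `|x' - x| <= e -> `|y' - y| <= e -> A * e <= `|x - y| ->
  `|x - y| <= expR s * `|x' - y'|.
Proof.
move=> e0 A0 s0 hA hx hy hxy.
have h1 : `|x - y| <= `|x' - y'| + 2 * e.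
  have := ler_normD (x - x') (x' - y); have := ler_normD (x' - y') (y' - y).
  rewrite distrC in hx.
  rewrite (_ : x - x' + (x' - y) = x - y); last by ring.
  rewrite (_ : x' - y' + (y' - y) = x' - y); last by ring.
  lra.
have h2 : 2 * e <= (1 - expR (- s)) * `|x - y|.
  apply: (@le_trans _ _ ((1 - expR (- s)) * (A * e))).
    by rewrite mulrCA mulrA; apply: ler_wpM2r.
  apply: ler_wpM2l => //; rewrite subr_ge0 -expR0 ler_expR; lra.
have h3 : expR (-s) * `|x - y| <= `|x' - y'| by lra.
by rewrite -(ler_pM2l (expR_gt0 (- s))) mulrA -expRD addNr expR0 mul1r.
Qed.

(** A total retraction onto the unit interval, so that variables which are
    only almost surely in it can be replaced by variables which always are. *)
Definition clamp x : R := Num.max 0 (Num.min 1 x).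

Lemma clamp01 x : 0 <= clamp x <= 1.
Proof. by rewrite /clamp le_max lexx /= ge_max ler01 ge_min lexx. Qed.

Lemma clamp_id x : 0 <= x <= 1 -> clamp x = x.
Proof. by case/andP=> x0 x1; rewrite /clamp (min_idPr x1) (max_idPr x0). Qed.

Lemma measurable_clamp : measurable_fun [set: R] clamp.
Proof. by apply: measurable_maxr => //; exact: measurable_minr. Qed.

End LogKernel.

(** * Energy and the Frostman condition *)

Section RandomVariables.
Context d (T : measurableType d) (R : realType) (P : probability T R).
Implicit Types X Y : T -> R.

Definition rv_energy X : \bar R :=
  (\int[P]_w \int[P]_z pos_log (X z - X w))%E.

(** Membership in closed intervals is written as |X - c| <= e, which is what
    the event that two values of X are close turns into when one of them is
    frozen. *)
Definition frostman X (M : R) :=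
  forall c e, 0 <= e -> (P [set w | (`|X w - c| <= e)%R] <= (M * e)%:E)%E.

Lemma measurable_dist_le X c e : measurable_fun setT X ->
  measurable [set w | (`|X w - c| <= e)%R].
Proof.
move=> mX; rewrite -[X in measurable X]setTI.
have mf : measurable_fun setT (fun w => `|X w - c|).
  by apply: measurableT_comp => //; apply: measurable_funB.
rewrite (_ : [set w | _] = (fun w => `|X w - c|) @^-1` `]-oo, e]%classic).
  exact: mf.
by apply/seteqP; split => w /=; rewrite in_itv.
Qed.

Lemma measurable_pos_log_sub X c : measurable_fun setT X ->
  measurable_fun setT (fun w => pos_log (X w - c)).
Proof.
move=> mX; apply: measurableT_comp; first exact: measurable_pos_log.
exact: measurable_funB.
Qed.

Lemma integralDcst_prob (f : T -> \bar R) (c : R) : 0 <= c ->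
  measurable_fun setT f -> (forall w, 0 <= f w)%E ->
  (\int[P]_w (f w + c%:E) = \int[P]_w f w + c%:E)%E.
Proof.
move=> c0 mf f0; rewrite ge0_integralD//.
by congr (_ + _)%E; rewrite integral_cst//= -[RHS]mule1 probability_setT.
Qed.

Lemma integral_cst_prob (c : \bar R) : (\int[P]_w c = c)%E.
Proof.
transitivity (c * P setT)%E; first exact: integral_cst.
by rewrite probability_setT mule1.
Qed.

End RandomVariables.

Section EnergyBounds.
Context d (T : measurableType d) (R : realType) (P : probability T R).
Implicit Types X Y : T -> R.

Lemma measurable_pos_log_pair X : measurable_fun setT X ->
  measurable_fun setT (fun p : T * T => pos_log (X p.1 - X p.2)).
Proof.
move=> mX; apply: measurableT_comp; first exact: measurable_pos_log.
by apply: measurable_funB; apply: measurableT_comp.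
Qed.

Lemma measurable_potential X : measurable_fun setT X ->
  measurable_fun setT (fun w => (\int[P]_z pos_log (X z - X w))%E).
Proof.
move=> mX.
pose f (p : T * T) := pos_log (X p.1 - X p.2).
have f0 p : (0 <= f p)%E by exact: pos_log_ge0.
exact: (measurable_fun_fubini_tonelli_G (m1 := P) f
  (measurable_pos_log_pair mX) f0).
Qed.

Lemma rv_energyE X : measurable_fun setT X ->
  rv_energy P X = (\int[(P \x P)]_p pos_log (X p.1 - X p.2))%E.
Proof.
move=> mX.
rewrite (fubini_tonelli2 (fun p : T * T => pos_log (X p.1 - X p.2)))//.
- exact: measurable_pos_log_pair.
- by move=> p; exact: pos_log_ge0.
Qed.

(** Pairs at distance at least A e pay s by [dist_le_perturbed]. The others
    pay L by the global expansion bound, and by the Frostman condition they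
    occur with probability at most M A e. *)
Lemma frostman_energy_perturb X X' (M A e s L : R) :
  measurable_fun setT X -> measurable_fun setT X' -> frostman P X M ->
  0 < A -> 0 <= e -> 0 <= s -> 0 <= L -> 2 <= A * (1 - expR (- s)) ->
  (forall w, `|X' w - X w| <= e) ->
  (forall z w, `|X z - X w| <= expR L * `|X' z - X' w|) ->
  (rv_energy P X' <= rv_energy P X + (s + L * (M * (A * e)))%:E)%E.
Proof.
move=> mX mX' fX A0 e0 s0 L0 hA he hL.
have pw w z : (pos_log (X' z - X' w) <= pos_log (X z - X w) + s%:E +
    L%:E * (\1_[set z | (`|X z - X w| <= A * e)%R] z)%:E)%E.
  have [h|h] := leP `|X z - X w| (A * e).
    rewrite indicE mem_set//= mule1.
    apply: (le_trans (le_pos_log L0 (hL z w))).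
    rewrite -addeA leeD2l// -EFinD lee_fin; lra.
  rewrite indicE memNset/= ?mule0 ?adde0; last by apply/negP; rewrite -ltNge.
  apply: le_pos_log => //; apply: dist_le_perturbed hA (he z) (he w) _ => //.
  exact: ltW.
have M0 : 0 <= L * (M * (A * e)).
  apply: mulr_ge0 => //; rewrite -lee_fin.
  apply: le_trans (fX 0 (A * e) _) => //.
  by rewrite mulr_ge0 // ltW.
have inner w : (\int[P]_z pos_log (X' z - X' w) <=
    \int[P]_z pos_log (X z - X w) + (s + L * (M * (A * e)))%:E)%E.
  have m1 : measurable_fun setT (fun z => (pos_log (X z - X w) + s%:E)%E).
    by apply: emeasurable_funD => //; exact: measurable_pos_log_sub.
  have m2 : measurable_fun setT (fun z =>
      (\1_[set z | (`|X z - X w| <= A * e)%R] z)%:E : \bar R).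
    by apply/measurable_EFinP; apply: measurable_indic; exact: measurable_dist_le.
  apply: (@le_trans _ _ (\int[P]_z (pos_log (X z - X w) + s%:E +
    L%:E * (\1_[set z | (`|X z - X w| <= A * e)%R] z)%:E))%E).
    apply: ge0_le_integral => //.
    - by move=> z _; exact: pos_log_ge0.
    - exact: measurable_pos_log_sub.
    - by apply: emeasurable_funD => //; apply: measurable_funeM.
  rewrite ge0_integralD//; last 3 first.
    - by move=> z _; rewrite adde_ge0 ?pos_log_ge0.
    - by move=> z _; rewrite mule_ge0.
    - exact: measurable_funeM.
  rewrite integralDcst_prob//; last 2 first.
    - exact: measurable_pos_log_sub.
    - by move=> z; exact: pos_log_ge0.
  rewrite -addeA leeD2l// ge0_integralZl//.
  rewrite integral_indic ?setIT//; last exact: measurable_dist_le.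
  rewrite EFinD leeD2l// EFinM lee_wpmul2l ?lee_fin//.
  by apply: fX; rewrite mulr_ge0 // ltW.
apply: (@le_trans _ _ (\int[P]_w (\int[P]_z pos_log (X z - X w) +
   (s + L * (M * (A * e)))%:E))%E).
  apply: ge0_le_integral => //.
  - by move=> w _; apply: integral_ge0 => z _; exact: pos_log_ge0.
  - exact: measurable_potential.
  - by apply: emeasurable_funD => //; exact: measurable_potential.
rewrite integralDcst_prob//.
- by rewrite addr_ge0.
- exact: measurable_potential.
- by move=> w; apply: integral_ge0 => z _; exact: pos_log_ge0.
Qed.

(** The scale 2^-k contributes ln 2 * M * 2^-k to the integral of the dyadic
    bound, a convergent geometric series. *)
Lemma frostman_potential Y (M : R) c : measurable_fun setT Y ->
  0 <= M -> frostman P Y M ->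
  (\int[P]_u pos_log (Y u - c) <= (2 * M * ln 2)%:E)%E.
Proof.
move=> mY M0 fY.
have l2 : 0 <= ln 2 :> R by apply: ln_ge0; lra.
pose B k := [set u | (`|Y u - c| <= 1 / (2 ^ k)%:R)%R].
have mB k : measurable_fun setT (fun u => (ln 2 * \1_(B k) u)%:E : \bar R).
  apply/measurable_EFinP; apply: measurable_funM => //.
  by apply: measurable_indic; exact: measurable_dist_le.
have B0 k u : (0 <= (ln 2 * \1_(B k) u)%:E :> \bar R)%E.
  by rewrite lee_fin mulr_ge0.
apply: (@le_trans _ _ (\int[P]_u \sum_(k <oo) (ln 2 * \1_(B k) u)%:E)%E).
  apply: ge0_le_integral => //.
  - by move=> u _; exact: pos_log_ge0.
  - exact: measurable_pos_log_sub.
  - exact: ge0_emeasurable_sum.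
  - by move=> u _; exact: pos_log_dyadic.
rewrite integral_nneseries//.
apply: le_trans (epsilon_trick0 xpredT _); last by rewrite !mulr_ge0.
apply: lee_nneseries => [k _ _|k _]; first by apply: integral_ge0 => u _; exact: B0.
under eq_integral do rewrite EFinM.
rewrite ge0_integralZl//; last first.
  by apply/measurable_EFinP; apply: measurable_indic; exact: measurable_dist_le.
rewrite integral_indic ?setIT//; last exact: measurable_dist_le.
apply: (@le_trans _ _ ((ln 2)%:E * (M * (1 / (2 ^ k)%:R))%:E)%E).
  by rewrite lee_wpmul2l ?lee_fin//; apply: fY; rewrite divr_ge0.
rewrite -EFinM lee_fin expnS natrM invfM.
have := ltr0n R (2 ^ k); rewrite expn_gt0 /= => h.
by rewrite le_eqVlt; apply/orP; left; apply/eqP; field; rewrite gt_eqF.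
Qed.

End EnergyBounds.

(** * Subdivision of the unit interval and smoothing *)

Section Cells.
Variable R : realType.
Implicit Types (n : nat) (x y : R).

(** The cap at n - 1 puts the endpoint 1 into the last cell. *)
Definition cell n x : nat := minn (Num.truncn (n%:R * x)) n.-1.

Lemma cell_lt n x : (0 < n)%N -> (cell n x < n)%N.
Proof. by case: n => // n _; rewrite /cell ltnS geq_minr. Qed.

Lemma cell_bounds n x : (0 < n)%N -> 0 <= x <= 1 ->
  (cell n x)%:R <= n%:R * x <= (cell n x)%:R + 1.
Proof.
move=> n0 /andP[x0 x1]; rewrite /cell.
have nx0 : 0 <= n%:R * x by rewrite mulr_ge0.
have := truncn_itv nx0 => /andP[h1 h2].
have hn : (n.-1)%:R + 1 = n%:R :> R by rewrite natr1 prednK.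
have nx1 : n%:R * x <= n%:R by rewrite ler_piMr.
have [h|h] := leqP (Num.truncn (n%:R * x)) n.-1.
  by rewrite h1 /= natr1 ltW.
rewrite hn nx1 andbT (le_trans _ h1)// ler_nat; exact: ltnW.
Qed.

Lemma le_cell n x y : x <= y -> (cell n x <= cell n y)%N.
Proof.
move=> xy; rewrite /cell leq_min geq_minr andbT.
by rewrite (leq_trans (geq_minl _ _))// le_truncn// ler_wpM2l.
Qed.

Lemma measurable_cell n : measurable_fun setT (fun x : R => (cell n x)%:R : R).
Proof.
apply: nondecreasing_measurable => // x y xy.
by rewrite ler_nat le_cell.
Qed.

End Cells.

Section Smoothing.
Context d (T : measurableType d) (R : realType) (P : probability T R).
Context d' (U : measurableType d') (Q : probability U R).
Variables (X : T -> R) (Y : U -> R).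
Hypotheses (mX : measurable_fun setT X) (mY : measurable_fun setT Y).
Hypotheses (X01 : forall w, 0 <= X w <= 1) (Y01 : forall u, 0 <= Y u <= 1).

(** When the law of Y is uniform, this is a uniformly distributed point of the
    cell of X. *)
Definition smooth (n : nat) (p : T * U) : R :=
  ((cell n (X p.1))%:R + Y p.2) / n%:R.

Lemma measurable_smooth n : measurable_fun setT (smooth n).
Proof.
apply: measurable_funM => //; apply: measurable_funD.
  apply: (measurableT_comp (@measurable_cell R n)).
  exact: (measurableT_comp mX).
exact: (measurableT_comp mY).
Qed.

Lemma mul_smooth n p : (0 < n)%N ->
  n%:R * smooth n p = (cell n (X p.1))%:R + Y p.2.
Proof. by move=> n0; rewrite /smooth mulrCA mulfV ?mulr1// pnatr_eq0 -lt0n. Qed.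

Lemma smooth_near n p : (0 < n)%N -> `|smooth n p - X p.1| <= n%:R^-1.
Proof.
move=> n0; have nR : 0 < n%:R :> R by rewrite ltr0n.
have := cell_bounds n0 (X01 p.1) => /andP[h1 h2].
have /andP[h3 h4] := Y01 p.2.
rewrite -(ler_pM2l nR) -{1}(ger0_norm (ltW nR)) -normrM mulfV ?gt_eqF//.
rewrite mulrBr mul_smooth// ler_norml.
by apply/andP; split; lra.
Qed.

Lemma smooth01 n p : (0 < n)%N -> 0 <= smooth n p <= 1.
Proof.
move=> n0; have nR : 0 < n%:R :> R by rewrite ltr0n.
have /andP[h3 h4] := Y01 p.2; apply/andP; split.
  by rewrite divr_ge0// addr_ge0.
rewrite ler_pdivrMr// mul1r.
have : (cell n (X p.1)).+1%:R <= n%:R :> R by rewrite ler_nat cell_lt.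
rewrite -natr1; lra.
Qed.

(** Given the first coordinate, [smooth n] is an affine image of Y with slope
    1/n; the bound holds fibre by fibre and is then averaged over P. *)
Lemma smooth_frostman n (M : R) : (0 < n)%N -> frostman Q Y M ->
  frostman (P \x Q)%E (smooth n) (n%:R * M).
Proof.
move=> n0 fY c e e0; have nR : 0 < n%:R :> R by rewrite ltr0n.
rewrite /= /product_measure1 /=.
apply: (@le_trans _ _ (\int[P]_w (cst (n%:R * M * e)%:E) w)%E); last first.
  by have /= -> := integral_cst_prob P (n%:R * M * e)%:E.
have mS := measurable_dist_le c e (measurable_smooth n).
apply: ge0_le_integral => //.
- exact: measurable_fun_xsection.
- move=> w _ /=; rewrite (_ : n%:R * M * e = M * (n%:R * e)); last by ring.
  apply: le_trans (fY (n%:R * c - (cell n (X w))%:R) (n%:R * e) _); last first.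
    by rewrite mulr_ge0.
  apply: le_measure; rewrite ?inE.
  + exact: measurable_xsection.
  + exact: measurable_dist_le.
  + move=> u; rewrite /xsection /= inE /= => h.
    rewrite -(ler_pM2l nR) -{1}(ger0_norm (ltW nR)) -normrM in h.
    by rewrite mulrBr mul_smooth// in h; rewrite opprB addrA (addrC (Y u)).
Qed.

(** Far pairs pay s, as for any displacement by 1/n. For a pair at distance
    less than A/n, averaging over the position in the cell gives at most
    ln n + 2 M ln 2 whatever the other point is, while the original kernel is
    at least ln (n / A). The additive excess 2 M ln 2 + ln A is absorbed by the
    multiplicative factor, because ln (n / A) is large. *)
Lemma smooth_potential (n : nat) (M A s th : R) (w : T) (q : T * U) :
  (0 < n)%N -> 0 <= M -> frostman Q Y M -> 1 <= A -> 0 <= s -> 0 <= th ->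
  2 <= A * (1 - expR (- s)) -> 2 * M * ln 2 + ln A <= th * ln (n%:R / A) ->
  (\int[Q]_u pos_log (smooth n (w, u) - smooth n q) <=
   (1 + th)%:E * pos_log (X w - X q.1) + s%:E)%E.
Proof.
move=> n0 M0 fY A1 s0 th0 hA hth; have nR : 0 < n%:R :> R by rewrite ltr0n.
have A0 : 0 < A by lra.
have [h|h] := leP (A * n%:R^-1) `|X w - X q.1|.
  apply: (@le_trans _ _ (\int[Q]_u cst (pos_log (X w - X q.1) + s%:E) u)%E).
    apply: ge0_le_integral => //.
    - by move=> u _; exact: pos_log_ge0.
    - apply: measurable_pos_log_sub.
      by apply: (measurableT_comp (measurable_smooth n)); exact: measurable_pair1.
    - move=> u _; apply: le_pos_log => //; apply: dist_le_perturbed hA _ _ h => //.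
      + exact: (smooth_near (w, u)).
      + exact: smooth_near.
  rewrite integral_cst_prob leeD2r//.
  by rewrite lee_pemull ?pos_log_ge0// lee_fin lerDl.
set c := n%:R * smooth n q - (cell n (X w))%:R.
have n1 : 1 <= n%:R :> R by rewrite ler1n.
have lnn : 0 <= ln n%:R :> R by rewrite ln_ge0.
apply: (@le_trans _ _ (\int[Q]_u (pos_log (Y u - c) + (ln n%:R)%:E))%E).
  apply: ge0_le_integral => //.
  - by move=> u _; exact: pos_log_ge0.
  - apply: measurable_pos_log_sub.
    by apply: (measurableT_comp (measurable_smooth n)); exact: measurable_pair1.
  - by apply: emeasurable_funD => //; exact: measurable_pos_log_sub.
  - move=> u _; apply: le_pos_log => //.
    rewrite lnK ?posrE// -{1}(ger0_norm (ltW nR)) -normrM /c mulrBr.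
    by rewrite !mul_smooth//= opprB addrA (addrC (Y u)).
rewrite integralDcst_prob//; last 2 first.
- exact: measurable_pos_log_sub.
- by move=> u; exact: pos_log_ge0.
apply: (@le_trans _ _ ((1 + th) * ln (n%:R / A))%:E).
  apply: (le_trans (leeD2r _ (frostman_potential _ mY M0 fY))).
  rewrite -EFinD lee_fin [ln (_ / _)]ln_div ?posrE// in hth *; lra.
apply: (@le_trans _ _ ((1 + th)%:E * pos_log (X w - X q.1))%E).
  rewrite EFinM lee_wpmul2l ?lee_fin//; first lra.
  have An0 : 0 < A * n%:R^-1 by rewrite divr_gt0.
  by have := ln_le_pos_log An0 (ltW h); rewrite -lnV// invf_div.
by rewrite leeDl.
Qed.

(** The bound of [smooth_potential] does not depend on the second coordinate
    of the frozen point, so two applications of Tonelli suffice. *)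
Lemma smooth_energy (n : nat) (M A s th : R) :
  (0 < n)%N -> 0 <= M -> frostman Q Y M -> 1 <= A -> 0 <= s -> 0 <= th ->
  2 <= A * (1 - expR (- s)) -> 2 * M * ln 2 + ln A <= th * ln (n%:R / A) ->
  (rv_energy (P \x Q)%E (smooth n) <= (1 + th)%:E * rv_energy P X + s%:E)%E.
Proof.
move=> n0 M0 fY A1 s0 th0 hA hth.
have th1 : 0 <= 1 + th by lra.
have mS := measurable_smooth n.
have inner q : (\int[(P \x Q)%E]_p pos_log (smooth n p - smooth n q) <=
   (1 + th)%:E * (\int[P]_w pos_log (X w - X q.1)) + s%:E)%E.
  rewrite (fubini_tonelli1 (fun p => pos_log (smooth n p - smooth n q)))/=; last 2 first.
  - exact: measurable_pos_log_sub.
  - by move=> p; exact: pos_log_ge0.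
  rewrite -ge0_integralZl//; last 2 first.
  - exact: measurable_pos_log_sub.
  - by move=> w _; exact: pos_log_ge0.
  rewrite -integralDcst_prob//; last 2 first.
  - by apply: measurable_funeM; exact: measurable_pos_log_sub.
  - by move=> w; rewrite mule_ge0 ?pos_log_ge0.
  apply: ge0_le_integral => //.
  - by move=> w _; apply: integral_ge0 => u _; exact: pos_log_ge0.
  - apply: (measurable_fun_fubini_tonelli_F (m2 := Q) (fun p => pos_log (smooth n p - smooth n q))).
    + exact: measurable_pos_log_sub.
    + by move=> p; exact: pos_log_ge0.
  - apply: emeasurable_funD => //; apply: measurable_funeM.
    exact: measurable_pos_log_sub.
  - by move=> w _; exact: (smooth_potential w q n0 M0 fY A1 s0 th0 hA hth).
pose F w := (\int[P]_z pos_log (X z - X w))%E.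
have mF : measurable_fun setT F by exact: measurable_potential.
have F0 w : (0 <= F w)%E by apply: integral_ge0 => u _; exact: pos_log_ge0.
have mG : measurable_fun setT (fun q : T * U => ((1 + th)%:E * F q.1 + s%:E)%E).
  apply: emeasurable_funD => //; apply: measurable_funeM.
  exact: (measurableT_comp mF).
have G0 q : (0 <= (1 + th)%:E * F q + s%:E)%E.
  by rewrite adde_ge0// mule_ge0.
apply: (@le_trans _ _ (\int[(P \x Q)%E]_q ((1 + th)%:E * F q.1 + s%:E))%E).
  apply: ge0_le_integral => //.
  - by move=> w _; apply: integral_ge0 => u _; exact: pos_log_ge0.
  - exact: measurable_potential.
rewrite (fubini_tonelli1 (fun q : T * U => ((1 + th)%:E * F q.1 + s%:E)%E))//=.
rewrite /fubini_F /=.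
under eq_integral do rewrite integral_cst_prob.
rewrite integralDcst_prob//; last 2 first.
- exact: measurable_funeM.
- by move=> w; rewrite mule_ge0.
by rewrite ge0_integralZl.
Qed.

End Smoothing.

Section Uniform.
Variable R : realType.

Definition unif : probability (measurableTypeR R) R := uniform_prob (@ltr01 R).

(** An interval of radius e has length 2 e. *)
Lemma unif_clamp_frostman : frostman unif (@clamp R : measurableTypeR R -> R) 2.
Proof.
move=> c e e0.
have mc : measurable_fun [set: measurableTypeR R] (@clamp R : measurableTypeR R -> R).
  exact: measurable_clamp.
have mB := measurable_dist_le c e mc.
set B := [set w | _] in mB *.
rewrite -[leLHS]mule1 -[X in (_ * X)%E]/(1%:E).
have -> : (unif B * 1 = \int[unif]_u (\1_B u)%:E)%E.
  by rewrite integral_indic// setIT mule1.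
rewrite /unif integral_uniform//; last first.
  by apply/measurable_EFinP; exact: measurable_indic.
rewrite subr0 invr1 mul1e.
apply: (@le_trans _ _ (\int[lebesgue_measure]_(x in `[0%R, 1%R])
   (\1_(`[c - e, c + e]%classic : set R) x)%:E)%E).
  apply: ge0_le_integral => //.
  - by apply/measurable_EFinP; apply: measurable_funTS; exact: measurable_indic.
  - by apply/measurable_EFinP; apply: measurable_funTS; exact: measurable_indic.
  - move=> u; rewrite /= in_itv /= => u01; rewrite lee_fin !indicE ler_nat.
    case: (boolP (u \in B)) => // /set_mem; rewrite /B /= clamp_id// => h.
    rewrite mem_set//= in_itv /=; move: h; rewrite ler_norml => /andP[h1 h2].
    by apply/andP; split; lra.
rewrite integral_indic//.
apply: (@le_trans _ _ (lebesgue_measure (`[c - e, c + e]%classic : set R))).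
  apply: le_measure; rewrite ?inE//=.
  exact: measurableI.
rewrite lebesgue_measure_itv /= lte_fin; case: ifPn => [_|_].
  rewrite -EFinB lee_fin; lra.
by rewrite lee_fin mulr_ge0.
Qed.

End Uniform.

(** * Borel structure of the complex plane and laws of real variables *)

Section ComplexBorel.
Variable R : realType.
Local Notation C := (complex R).
Local Notation Ctop := ((C : numFieldType)^o).

Lemma Re_le_normc (z : C) : `|complex.Re z| <= ComplexField.Normc.normc z.
Proof.
by case: z => a b /=; rewrite -sqrtr_sqr ler_wsqrtr// lerDl sqr_ge0.
Qed.

Lemma Im_le_normc (z : C) : `|complex.Im z| <= ComplexField.Normc.normc z.
Proof.
by case: z => a b /=; rewrite -sqrtr_sqr ler_wsqrtr// lerDr sqr_ge0.
Qed.

(** Covers the real and the imaginary part at once: such a map is continuous,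
    and the sigma-algebra is generated by the open sets. *)
Lemma measurable_contraction (p : C -> R) :
  (forall z w, `|p z - p w| <= ComplexField.Normc.normc (z - w)) ->
  measurable_fun [set: borelC R] (p : borelC R -> R).
Proof.
move=> hp; apply: (measurability _ (RGenOpens.measurableE R)) => //.
move=> _ [_ [a [b ->] <-]]; rewrite setTI; apply: sub_sigma_algebra.
set O := `]a, b[%classic; have oO : open O by exact: interval_open.
suff: open ((p : Ctop -> R) @^-1` O) by [].
rewrite openE => z /= Oz.
have /nbhs_ballP [e /= e0 eO] : nbhs (p z) O by exact: open_nbhs_nbhs.
apply/nbhs_ballP; exists (real_complex R e); first by rewrite /= ltcR.
move=> w; rewrite /ball /= /ball_ => zw; apply: eO; rewrite /ball /=.
by apply: le_lt_trans (hp _ _) _; rewrite -ltcR.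
Qed.

Lemma measurable_Re : measurable_fun [set: borelC R] (@complex.Re R : borelC R -> R).
Proof.
apply: measurable_contraction => z w.
by move: (Re_le_normc (z - w)); case: z w => [a b] [c d].
Qed.

Lemma measurable_Im : measurable_fun [set: borelC R] (@complex.Im R : borelC R -> R).
Proof.
apply: measurable_contraction => z w.
by move: (Im_le_normc (z - w)); case: z w => [a b] [c d].
Qed.

Lemma measurable_real_complex :
  measurable_fun setT (real_complex R : R -> borelC R).
Proof.
apply: (@measurability _ _ R (borelC R) setT (real_complex R) (@open Ctop)) => //.
move=> _ [U oU <-]; rewrite setTI; apply: open_measurable.
rewrite openE => x /= Ux.
have /nbhs_ballP [e /= e0 eO] : nbhs (real_complex R x : Ctop) U.
  exact: open_nbhs_nbhs.
move: e0 eO; rewrite ltcE /= => /andP[/eqP Ime e0] eO.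
apply/nbhs_ballP; exists (complex.Re e) => //=.
move=> y; rewrite /ball /= => xy; apply: eO; rewrite /ball /= /ball_.
rewrite ltcE/= Ime eqxx /= subr0 expr0n /= addr0 sqrtr_sqr.
exact: xy.
Qed.

Lemma measurable_toC (A : set R) : measurable A -> measurable (toC A : set (borelC R)).
Proof.
move=> mA; rewrite (_ : toC A =
  ([set: borelC R] `&` (@complex.Re R : borelC R -> R) @^-1` A) `&`
  ([set: borelC R] `&` (@complex.Im R : borelC R -> R) @^-1` [set 0])).
  apply: measurableI; first exact: measurable_Re.
  by apply: measurable_Im => //; exact: measurable_set1.
apply/seteqP; split => [_ [x Ax <-]|[a b] [[_ /= Aa] [_ /= ->]]]; last by exists a.
by split; split.
Qed.

Lemma log_kernelE (z w : C) : log_kernel z w =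
  (- lne (Num.sqrt ((complex.Re z - complex.Re w) ^+ 2 +
     (complex.Im z - complex.Im w) ^+ 2))%:E)%E.
Proof. by case: z w => [a b] [c d]. Qed.

Lemma measurable_log_kernel :
  measurable_fun setT (fun p : borelC R * borelC R => log_kernel p.1 p.2).
Proof.
under eq_fun do rewrite log_kernelE.
apply: measurableT_comp => //; apply: (measurableT_comp (@measurable_lne R)).
apply: measurableT_comp; first exact: continuous_measurable_fun (@sqrt_continuous R).
apply: measurable_funD; apply: measurable_funX; apply: measurable_funB.
- exact: (measurableT_comp measurable_Re).
- exact: (measurableT_comp measurable_Re).
- exact: (measurableT_comp measurable_Im).
- exact: (measurableT_comp measurable_Im).
Qed.

(** The kernel takes both signs, so Tonelli is applied to its positive and
    negative parts separately. *)
Lemma measurable_log_potential (mu : probability (borelC R) R) :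
  measurable_fun setT (fun w : borelC R => (\int[mu]_z log_kernel z w)%E).
Proof.
pose f (p : borelC R * borelC R) : \bar R := log_kernel p.1 p.2.
have mf : measurable_fun setT f by exact: measurable_log_kernel.
rewrite (_ : (fun w => _) = (fun w => fubini_G mu f^\+ w - fubini_G mu f^\-w))%E.
  apply: emeasurable_funB; apply: measurable_fun_fubini_tonelli_G.
  - exact: measurable_funepos.
  - by move=> p; exact: funepos_ge0.
  - exact: measurable_funeneg.
  - by move=> p; exact: funeneg_ge0.
apply/funext => w; rewrite integralE; congr (_ - _)%E; apply: eq_integral => z _.
- by rewrite !funeposE.
- by rewrite !funenegE.
Qed.

Definition clampRe (z : borelC R) : R := clamp (complex.Re z).

Lemma measurable_clampRe : measurable_fun setT clampRe.
Proof. exact: (measurableT_comp (@measurable_clamp R) measurable_Re). Qed.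

Lemma clampRe01 z : 0 <= clampRe z <= 1. Proof. exact: clamp01. Qed.

Lemma log_kernel_unit (x y : R) : 0 <= x <= 1 -> 0 <= y <= 1 ->
  log_kernel (real_complex R x) (real_complex R y) = pos_log (x - y).
Proof.
move=> /andP[x0 x1] /andP[y0 y1].
rewrite log_kernelE /= subr0 expr0n /= addr0 sqrtr_sqr /pos_log.
rewrite (max_idPr _)// oppe_ge0.
have [->|h] := eqVneq (x - y) 0; first by rewrite normr0 le0_lneNy// leNye.
rewrite lne_EFin ?normr_gt0// lee_fin -ln1 ler_ln ?posrE ?normr_gt0//.
by rewrite ler_norml; apply/andP; split; lra.
Qed.

Lemma ae_toC (mu : probability (borelC R) R) (f g : borelC R -> \bar R) :
  prob_on (toC `[0, 1]) mu ->
  (forall x, 0 <= x <= 1 -> f (real_complex R x) = g (real_complex R x)) ->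
  ae_eq mu setT f g.
Proof.
move=> mu01 fg; exists (~` toC (`[0, 1]%classic : set R)); split.
- by apply: measurableC; apply: measurable_toC; exact: measurable_itv.
- exact: mu01.
- move=> z /= h [x x01 xz]; apply: h => _; rewrite -xz.
  by apply: fg; move: x01; rewrite /= in_itv.
Qed.

(** On the unit interval distances are at most 1, where the kernel and its
    truncation agree, and the rest of the plane is a null set. *)
Lemma energy_unit (mu : probability (borelC R) R) :
  prob_on (toC `[0, 1]) mu -> energy mu = rv_energy mu clampRe.
Proof.
move=> mu01; apply: ae_eq_integral => //.
- exact: measurable_log_potential.
- exact: (measurable_potential mu measurable_clampRe).
apply: ae_toC => // y y01; apply: ae_eq_integral => //.
- exact: (measurableT_comp measurable_log_kernel
    (measurable_pair2 (real_complex R y : borelC R))).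
- exact: measurable_pos_log_sub measurable_clampRe.
apply: ae_toC => // x x01.
by rewrite log_kernel_unit// /clampRe /= !clamp_id.
Qed.

End ComplexBorel.

Lemma exists_law d1 d2 (T1 : measurableType d1) (T2 : measurableType d2)
    (R : realType) (P : probability T1 R) (f : T1 -> T2) :
  measurable_fun setT f ->
  exists nu : probability T2 R, (forall A, nu A = P (f @^-1` A)) /\
    forall g : T2 -> \bar R, measurable_fun setT g -> (forall y, 0 <= g y)%E ->
      (\int[nu]_y g y = \int[P]_x g (f x))%E.
Proof.
move=> mf; pose mixin := isMeasurableFun.Build _ _ _ _ _ mf.
pose X : {mfun T1 >-> T2} := HB.pack f mixin.
exists (distribution P X); split => // g mg g0.
by rewrite ge0_integral_distribution.
Qed.

Section Law.
Context d (T : measurableType d) (R : realType) (P : probability T R).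

(** Turns a random variable with values in A into a competitor for the
    capacity of A. *)
Lemma exists_energy_law (X : T -> R) (A : set R) :
  measurable_fun setT X -> (forall w, 0 <= X w <= 1) ->
  (forall w, A (X w)) ->
  exists2 nu : probability (borelC R) R,
    prob_on (toC A) nu & energy nu = rv_energy P X.
Proof.
move=> mX X01 AX.
have mf : measurable_fun setT (real_complex R \o X : T -> borelC R).
  exact: (measurableT_comp (@measurable_real_complex R) mX).
have [nu [nuE int_nu]] := exists_law P mf.
have nu0 B : (forall w, B (X w)) -> prob_on (toC B) nu.
  move=> BX; rewrite /prob_on /= nuE (_ : _ @^-1` _ = set0) ?measure0//.
  by apply/seteqP; split => // w /=; apply; exists (X w).
exists nu; first exact: nu0.
rewrite energy_unit; last first.
  by apply: nu0 => w; rewrite /= in_itv; exact: X01.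
rewrite /rv_energy int_nu; last 2 first.
- exact: (measurable_potential nu (@measurable_clampRe R)).
- by move=> w; apply: integral_ge0 => z _; exact: pos_log_ge0.
apply: eq_integral => w _; rewrite int_nu; last 2 first.
- exact: (measurable_pos_log_sub _ (@measurable_clampRe R)).
- by move=> z; exact: pos_log_ge0.
by apply: eq_integral => z _; rewrite /clampRe /= !clamp_id.
Qed.

End Law.

(** * Squeezing into V n *)

Section Squeeze.
Variable R : realType.
Variable r : nat -> R.
Hypothesis r_gt0 : forall n : nat, (1 <= n)%N -> 0 < r n.
Hypothesis r_lt : forall n : nat, (1 <= n)%N -> r n < 1 / n%:R.

Definition ratio n := n%:R * r n / 2.

(** On a cell this is the homothety of factor [ratio n] about the midpoint. In
    this form it is a sum of nondecreasing functions, which yields at once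
    measurability and the lower bound [squeeze_lower]. *)
Definition squeeze n (x : R) :=
  (1 - ratio n) * midpt R (cell n x) n + ratio n * x.

Lemma ratio_bounds n : (0 < n)%N -> 0 < ratio n < 1 / 2.
Proof.
move=> n0; have nR : 0 < n%:R :> R by rewrite ltr0n.
have := r_lt n0; rewrite ltr_pdivlMr// mulrC => h.
have h' : 0 < n%:R * r n by rewrite mulr_gt0// r_gt0.
by rewrite /ratio; apply/andP; split; lra.
Qed.

Lemma midptE j n : (0 < n)%N -> midpt R j n = (j%:R + 1 / 2) / n%:R.
Proof.
move=> n0; rewrite /midpt natrD !natrM; field.
by rewrite pnatr_eq0 -lt0n.
Qed.

Lemma midpt_near n x : (0 < n)%N -> 0 <= x <= 1 ->
  `|x - midpt R (cell n x) n| <= n%:R^-1 / 2.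
Proof.
move=> n0 x01; have nR : 0 < n%:R :> R by rewrite ltr0n.
have /andP[h1 h2] := cell_bounds n0 x01.
rewrite midptE// -(ler_pM2l nR) -{1}(ger0_norm (ltW nR)) -normrM mulrBr.
rewrite mulrCA mulfV ?gt_eqF// mulr1 mulrA mulfV ?gt_eqF// ler_norml.
by apply/andP; split; lra.
Qed.

Lemma squeeze_near n x : (0 < n)%N -> 0 <= x <= 1 ->
  `|squeeze n x - x| <= n%:R^-1.
Proof.
move=> n0 x01; have /andP[a0 a1] := ratio_bounds n0.
rewrite (_ : _ - x = (1 - ratio n) * (midpt R (cell n x) n - x)); last first.
  by rewrite /squeeze; ring.
rewrite normrM [X in _ * X]distrC gtr0_norm; last by lra.
have h := midpt_near n0 x01.
have n1 : 0 <= n%:R^-1 :> R by rewrite invr_ge0.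
apply: (@le_trans _ _ (1 * (n%:R^-1 / 2))); last by lra.
by apply: ler_pM => //; lra.
Qed.

Lemma squeeze_midpt n x : (0 < n)%N -> 0 <= x <= 1 ->
  `|squeeze n x - midpt R (cell n x) n| <= r n / 4.
Proof.
move=> n0 x01; have /andP[a0 a1] := ratio_bounds n0.
have nR : 0 < n%:R :> R by rewrite ltr0n.
rewrite (_ : _ - _ = ratio n * (x - midpt R (cell n x) n)); last first.
  by rewrite /squeeze; ring.
rewrite normrM gtr0_norm//.
rewrite (_ : r n / 4 = ratio n * (n%:R^-1 / 2)); last first.
  by rewrite /ratio; field; rewrite gt_eqF.
by rewrite ler_pM2l// midpt_near.
Qed.

(** The image of [squeeze n] keeps a margin r n / 4 inside V n, which later
    displacements may use up. *)
Lemma squeeze_V n x y : (0 < n)%N -> 0 <= x <= 1 ->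
  `|y - squeeze n x| < r n / 4 -> V r n y.
Proof.
move=> n0 x01 h; exists (cell n x); first exact: cell_lt.
rewrite /J /= in_itv /=.
have h2 := squeeze_midpt n0 x01.
have h3 : `|y - midpt R (cell n x) n| < r n / 2.
  rewrite (_ : y - _ = (y - squeeze n x) + (squeeze n x - midpt R (cell n x) n)); last by ring.
  apply: (le_lt_trans (ler_normD _ _)); lra.
by move: h3; rewrite ltr_norml => /andP[]; move=> *; apply/andP; split; lra.
Qed.

Lemma le_midpt i j n : (i <= j)%N -> midpt R i n <= midpt R j n.
Proof.
move=> ij; rewrite /midpt ler_wpM2r ?invr_ge0// ler_nat.
by rewrite leq_add2r leq_mul2l ij orbT.
Qed.

Lemma squeeze_lower n x y : (0 < n)%N -> x <= y ->
  ratio n * (y - x) <= squeeze n y - squeeze n x.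
Proof.
move=> n0 xy; have /andP[a0 a1] := ratio_bounds n0.
have := le_midpt n (le_cell n xy).
rewrite -subr_ge0 => h.
have : 0 <= (1 - ratio n) * (midpt R (cell n y) n - midpt R (cell n x) n).
  by rewrite mulr_ge0//; lra.
rewrite /squeeze; lra.
Qed.

(** The inverse of [squeeze n] is Lipschitz across cells as well, because the
    midpoints are ordered like the points. *)
Lemma squeeze_expand n x y : (0 < n)%N ->
  `|x - y| <= expR (- ln (ratio n)) * `|squeeze n x - squeeze n y|.
Proof.
move=> n0; have /andP[a0 a1] := ratio_bounds n0.
rewrite expRN lnK ?posrE//.
wlog xy : x y / x <= y => [hwlog|].
  have [|/ltW] := leP x y; first exact: hwlog.
  by rewrite distrC (distrC (squeeze _ _)); exact: hwlog.
have h := squeeze_lower n0 xy.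
rewrite ler_pdivlMl// distrC ger0_norm ?subr_ge0//.
by apply: le_trans h _; rewrite distrC ler_norm.
Qed.

Lemma measurable_squeeze n : measurable_fun setT (squeeze n).
Proof.
apply: measurable_funD; last exact: measurable_funM.
apply: measurable_funM => //.
apply: nondecreasing_measurable => // x y xy.
by apply: le_midpt; exact: le_cell.
Qed.

Lemma V01 n y : (0 < n)%N -> V r n y -> 0 <= y <= 1.
Proof.
move=> n0 [j /= jn]; rewrite /J /= in_itv /= midptE//.
have nR : 0 < n%:R :> R by rewrite ltr0n.
have rn := r_lt n0; move=> /andP[h1 h2].
have jn' : j%:R + 1 <= n%:R :> R by rewrite natr1 ler_nat.
have j0 : 0 <= j%:R :> R by [].
have e1 : (j%:R + 1 / 2) / n%:R = j%:R / n%:R + n%:R^-1 / 2 :> R.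
  by field; rewrite gt_eqF.
have e2 : 0 <= j%:R / n%:R :> R by rewrite divr_ge0.
have e3 : j%:R / n%:R + n%:R^-1 <= 1 :> R.
  by rewrite -[X in _ + X]mul1r -mulrDl ler_pdivrMr// mul1r.
by apply/andP; split; lra.
Qed.

End Squeeze.

Section Step.
Context d (T : measurableType d) (R : realType) (P : probability T R).

(** If X' comes within e of c at some w0, then wherever it does so again X is
    within 2 C e of X w0. *)
Lemma frostman_expand (X X' : T -> R) (M C : R) :
  measurable_fun setT X -> measurable_fun setT X' -> 0 <= M -> 0 <= C ->
  (forall z w, `|X z - X w| <= C * `|X' z - X' w|) ->
  frostman P X M -> frostman P X' (2 * C * M).
Proof.
move=> mX mX' M0 C0 hC fX c e e0.
have [[w0 hw0]|no] := pselect (exists w, `|X' w - c| <= e); last first.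
  rewrite (_ : [set _ | _] = set0) ?measure0; last first.
    by apply/seteqP; split => // w /= h; apply: no; exists w.
  by rewrite lee_fin !mulr_ge0.
have Ce : 0 <= C * (2 * e) by rewrite !mulr_ge0.
have := fX (X w0) _ Ce; rewrite (_ : M * _ = 2 * C * M * e); last by ring.
apply: le_trans; apply: le_measure; rewrite ?inE; [exact: measurable_dist_le..|].
move=> w /= hw; apply: (le_trans (hC w w0)); rewrite ler_wpM2l//.
rewrite (_ : X' w - X' w0 = (X' w - c) - (X' w0 - c)); last by ring.
by apply: (le_trans (ler_normB _ _)); lra.
Qed.

Variable r : nat -> R.
Hypothesis r_gt0 : forall n : nat, (1 <= n)%N -> 0 < r n.
Hypothesis r_lt : forall n : nat, (1 <= n)%N -> r n < 1 / n%:R.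
Hypothesis r_log : (fun n : nat => `|ln (r n)|) =o_\oo (fun n : nat => n%:R : R).

(** The logarithm of 2 / (n r_n) is at most ln 2 + |ln r_n|, and both terms
    are o(n). *)
Lemma ln_ratio_small (h : R) : 0 < h -> \forall n \near \oo,
  - ln (ratio r n) <= h * n%:R.
Proof.
move=> h0; have h20 : 0 < h / 2 by rewrite divr_gt0.
move/eqoP: r_log => /(_ _ h20) hr.
near=> n.
have n0 : (0 < n)%N by near: n; exists 1%N.
have nR : 0 < n%:R :> R by rewrite ltr0n.
have h1 : `|ln (r n)| <= h / 2 * n%:R.
  have : `| `|ln (r n)| | <= h / 2 * `|n%:R : R| by near: n.
  by rewrite normr_id (@ger0_norm _ n%:R).
have h2 : ln 2 <= h / 2 * n%:R.
  rewrite mulrC -ler_pdivrMr//; near: n; exact: nbhs_infty_ger.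
have h3 : 0 <= ln n%:R :> R by rewrite ln_ge0// ler1n.
rewrite /ratio ln_div ?posrE ?mulr_gt0 ?r_gt0// lnM ?posrE ?r_gt0//.
have := ler_norm (- ln (r n)); rewrite normrN; lra.
Unshelve. all: by end_near. Qed.

(** First A is fixed so large that far pairs pay at most e / 2; then n is
    chosen so large that close pairs do too. *)
Lemma squeeze_energy (X : T -> R) (M e : R) (N : nat) :
  measurable_fun setT X -> (forall w, 0 <= X w <= 1) -> 0 <= M ->
  frostman P X M -> 0 < e ->
  exists n, [/\ (N <= n)%N, (0 < n)%N &
    (rv_energy P (squeeze r n \o X) <= rv_energy P X + e%:E)%E].
Proof.
move=> mX X01 M0 fX e0.
have e20 : 0 < e / 2 by rewrite divr_gt0.
pose A : R := 2 / (1 - expR (- (e / 2))).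
have hA0 : 0 < 1 - expR (- (e / 2)).
  by rewrite subr_gt0 expR_lt1 oppr_lt0.
have A0 : 0 < A by rewrite divr_gt0.
have MA0 : 0 <= M * A by rewrite mulr_ge0// ltW.
pose h : R := e / 2 / (M * A + 1).
have h0 : 0 < h by rewrite divr_gt0//; lra.
have [K _ hK] := ln_ratio_small h0.
pose n := maxn 1 (maxn N K).
have n0 : (0 < n)%N by rewrite leq_max.
have nN : (N <= n)%N by rewrite /n !leq_max leqnn orbT.
have nK : (K <= n)%N by rewrite /n !leq_max leqnn !orbT.
exists n; split => //.
have nR : 0 < n%:R :> R by rewrite ltr0n.
have hn := hK n nK.
have /andP[a0 a1] := ratio_bounds r_gt0 r_lt n0.
have L0 : 0 <= - ln (ratio r n).
  by rewrite oppr_ge0 -ln1 ler_ln ?posrE//; lra.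
apply: (@le_trans _ _ (rv_energy P X +
   (e / 2 + - ln (ratio r n) * (M * (A * n%:R^-1)))%:E)%E).
  apply: frostman_energy_perturb => //.
  - by apply: measurableT_comp => //; exact: measurable_squeeze.
  - exact: ltW.
  - by rewrite /A mulfVK// gt_eqF.
  - by move=> w; exact: squeeze_near.
  - by move=> z w; exact: squeeze_expand.
rewrite leeD2l// lee_fin.
have : - ln (ratio r n) * (M * (A * n%:R^-1)) <= e / 2.
  apply: (@le_trans _ _ (h * n%:R * (M * (A * n%:R^-1)))).
    by rewrite ler_wpM2r// mulrA divr_ge0.
  rewrite (_ : h * n%:R * _ = h * (M * A)); last by field; rewrite gt_eqF.
  rewrite /h mulrAC ler_pdivrMr; last by lra.
  by rewrite ler_pM2l//; lra.
lra.
Qed.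

End Step.

(** * Iteration and passage to the limit *)

Section LowerSemicontinuity.
Variable R : realType.

Lemma le_limn_einf (u : (\bar R)^nat) (c : \bar R) :
  (\forall n \near \oo, c <= u n)%E -> (c <= limn_einf u)%E.
Proof.
move=> [N _ hN]; rewrite limn_einf_lim.
apply: (@le_trans _ _ (einfs u N)).
  by apply/ereal_infP => _ [k /= Nk <-]; exact: hN.
rewrite (cvg_lim _ (cvg_einfs_sup (u := u)))//.
by apply: ereal_sup_ubound; exists N.
Qed.

Lemma limn_einf_ub (u : (\bar R)^nat) (c : \bar R) :
  (forall n, u n <= c)%E -> (limn_einf u <= c)%E.
Proof.
move=> uc; rewrite limn_einf_lim; apply: lime_le; first exact: is_cvg_einfs.
apply: nearW => n; apply: le_trans (uc n).
by apply: ereal_inf_lbound; exists n => /=.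
Qed.

Lemma lee_real_below (a b : \bar R) :
  (forall c : R, (c%:E < a)%E -> (c%:E <= b)%E) -> (a <= b)%E.
Proof.
move=> h; rewrite leNgt; apply/negP; case: b h => [b h|h|h].
- case: a h => [a h|h _|//]; last first.
    have := h (b + 1) (ltry _); rewrite lee_fin; lra.
  rewrite lte_fin => ba; have := h ((a + b) / 2).
  by rewrite lte_fin lee_fin => /(_ ltac:(lra)); lra.
- by rewrite ltNge leey.
- case: a h => [a h|h|//] _.
    by have := h (a - 1); rewrite lte_fin => /(_ ltac:(lra)).
  by have := h 0 (ltry _).
Qed.

Lemma pos_log_lsc (u : R^nat) (l : R) : u n @[n --> \oo] --> l ->
  (pos_log l <= limn_einf (fun n => pos_log (u n)))%E.
Proof.
move=> ul; apply: lee_real_below => c cl; apply: le_limn_einf.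
have [c0|c0] := leP c 0.
  by apply: nearW => n; apply: le_trans (pos_log_ge0 _); rewrite lee_fin.
(* for c > 0, the inequality c < pos_log l says that |l| < exp (- c), an
   open condition on l *)
have lc : `|l| < expR (- c).
  have [->|l0] := eqVneq l 0; first by rewrite normr0 expR_gt0.
  move: cl; rewrite pos_log_neq0// lte_fin lt_max ltNge (ltW c0) /= => cl.
  by rewrite -ltr_ln ?posrE ?normr_gt0 ?expR_gt0// expRK; lra.
have : `|u n| @[n --> \oo] --> `|l| by exact: cvg_norm.
move/(cvgr_lt _) => /(_ _ lc); apply: filterS => n un.
have := ln_le_pos_log (expR_gt0 (- c)) (ltW un).
by rewrite expRK opprK.
Qed.

End LowerSemicontinuity.

Section Limit.
Context d (T : measurableType d) (R : realType) (P : probability T R).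

Lemma rv_energy_limit (X : (T -> R)^nat) (Y : T -> R) (c : \bar R) :
  (forall k, measurable_fun setT (X k)) -> measurable_fun setT Y ->
  (forall w, X k w @[k --> \oo] --> Y w) ->
  (forall k, rv_energy P (X k) <= c)%E -> (rv_energy P Y <= c)%E.
Proof.
move=> mX mY XY Xc; rewrite rv_energyE//.
pose f k (p : T * T) := pos_log (X k p.1 - X k p.2).
apply: (@le_trans _ _ (\int[(P \x P)%E]_p limn_einf (f^~ p))%E).
  apply: ge0_le_integral => //.
  - by move=> p _; exact: pos_log_ge0.
  - exact: measurable_pos_log_pair.
  - apply: (emeasurable_fun_cvg (fun k p => einfs (f^~ p) k)).
      by apply: measurable_fun_einfs => k; exact: measurable_pos_log_pair.
    by move=> p _; rewrite limn_einf_lim; exact: is_cvg_einfs.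
  - by move=> p _; apply: pos_log_lsc; apply: cvgB; exact: XY.
apply: (@le_trans _ _ (limn_einf (fun k => \int[(P \x P)%E]_p f k p))%E).
  apply: fatou => // [k|k p _]; first exact: measurable_pos_log_pair.
  exact: pos_log_ge0.
by apply: limn_einf_ub => k; rewrite -rv_energyE.
Qed.

Variable r : nat -> R.
Hypothesis r_gt0 : forall n : nat, (1 <= n)%N -> 0 < r n.
Hypothesis r_lt : forall n : nat, (1 <= n)%N -> r n < 1 / n%:R.
Hypothesis r_log : (fun n : nat => `|ln (r n)|) =o_\oo (fun n : nat => n%:R : R).

(** State of the iteration: the current variable, the index of the last
    squeeze, and the energy increase still allowed. *)
Record stage := Stage {
  stage_var : T -> R;
  stage_index : nat;
  stage_slack : R }.

Definition admissible (s : stage) := [/\ measurable_fun setT (stage_var s),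
  forall w, 0 <= stage_var s w <= 1,
  exists2 M, 0 <= M & frostman P (stage_var s) M,
  (0 < stage_index s)%N & 0 < stage_slack s].

(** The next index n' satisfies 1 / n' <= r_n / 16, so that the displacements
    still to come fit in the margin r_n / 4. The sum of energy and slack does
    not increase, which replaces a summation of the errors. *)
Definition refines (s t : stage) := [/\
  stage_var t = squeeze r (stage_index t) \o stage_var s,
  16 / r (stage_index s) <= (stage_index t)%:R &
  (rv_energy P (stage_var t) + (stage_slack t)%:E <=
   rv_energy P (stage_var s) + (stage_slack s)%:E)%E].

Lemma exists_refinement s : admissible s ->
  exists2 t, admissible t & refines s t.
Proof.
case: s => X m e [/= mX X01 [M M0 fX] m0 e0].
have e20 : 0 < e / 2 by rewrite divr_gt0.
pose N := (Num.truncn (16 / r m)).+1.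
have [n [Nn n0 nE]] := squeeze_energy r_gt0 r_lt r_log N mX X01 M0 fX e20.
have mS : measurable_fun setT (squeeze r n \o X).
  by apply: measurableT_comp => //; exact: measurable_squeeze.
have /andP[a0 a1] := ratio_bounds r_gt0 r_lt n0.
exists (Stage (squeeze r n \o X) n (e / 2)); split => //=.
- move=> w; apply: (V01 r_lt n0); apply: (squeeze_V r_gt0 r_lt n0 (X01 w)).
  by rewrite subrr normr0 divr_gt0// r_gt0.
- exists (2 * expR (- ln (ratio r n)) * M).
    by rewrite !mulr_ge0// expR_ge0.
  apply: (frostman_expand mX mS M0 (expR_ge0 _) _ fX).
  by move=> z w; exact: squeeze_expand.
- by rewrite (le_trans (ltW (truncnS_gt _)))// ler_nat.
- by apply: (le_trans (leeD2r _ nE)); rewrite -addeA -EFinD -splitr.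
Qed.

(** The values at w of the successive variables are the centres of nested
    intervals of radii r_(n_k) / 8, and Y w is their common point. It is within
    r_(n_k) / 8 of the k-th value, hence in V (n_k) for every k >= 1. *)
Lemma exists_Gdelta_variable (X : T -> R) (M e : R) :
  measurable_fun setT X -> (forall w, 0 <= X w <= 1) -> 0 <= M ->
  frostman P X M -> 0 < e ->
  exists Y : T -> R, [/\ measurable_fun setT Y,
    forall w, uniform_Gdelta r (Y w) &
    (rv_energy P Y <= rv_energy P X + e%:E)%E].
Proof.
move=> mX X01 M0 fX e0.
pose s0 := {| stage_var := X; stage_index := 1; stage_slack := e |}.
have adm0 : admissible s0 by split => //=; exists M.
pose S := {s | admissible s}.
have next (s : S) : {t : S | refines (sval s) (sval t)}.
  apply: cid; case: s => s adm; have [t admt st] := exists_refinement adm.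
  by exists (exist _ t admt).
have [s [s_0 ref]] := dependent_choice next (exist _ s0 adm0).
pose U k := stage_var (sval (s k)).
pose n k := stage_index (sval (s k)).
have mU k : measurable_fun setT (U k) by case: (svalP (s k)).
have U01 k w : 0 <= U k w <= 1 by case: (svalP (s k)) => _ h *; exact: h.
have n0 k : (0 < n k)%N by case: (svalP (s k)).
have nR k : 0 < (n k)%:R :> R by rewrite ltr0n.
have rn0 k : 0 < r (n k) by exact: r_gt0.
have UE k : U k.+1 = squeeze r (n k.+1) \o U k by case: (ref k).
have nr k : (n k.+1)%:R^-1 <= r (n k) / 16.
  have [_ h _] := ref k; rewrite -[leRHS]invrK invf_div lef_pV2 ?posrE//.
  by rewrite divr_gt0.
have rn1 k : r (n k) < (n k)%:R^-1 by rewrite -[ltRHS]mul1r; exact: r_lt.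
have moved k w : `|U k.+1 w - U k w| <= r (n k) / 16.
  by rewrite UE; apply: le_trans (nr k); exact: squeeze_near.
have rr k : r (n k.+1) <= r (n k) / 16 by apply: ltW; apply: lt_le_trans (nr k).
(* r_n / 16 of displacement and a new radius of at most r_n / 128 fit in r_n / 8 *)
have nested k w : U k w - r (n k) / 8 <= U k.+1 w - r (n k.+1) / 8 /\
    U k.+1 w + r (n k.+1) / 8 <= U k w + r (n k) / 8.
  have := moved k w; have := rr k; have := rn0 k.
  by rewrite ler_norml => a b /andP[c1 c2]; split; lra.
have lo_incr w : {homo (fun k => U k w - r (n k) / 8) : i j / (i <= j)%N >-> i <= j}.
  by apply/nondecreasing_seqP => k; case: (nested k w).
have hi_decr w : {homo (fun k => U k w + r (n k) / 8) : i j / (i <= j)%N >-> j <= i}.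
  by apply/nonincreasing_seqP => k; case: (nested k w).
have lo_hi w i j : U i w - r (n i) / 8 <= U j w + r (n j) / 8.
  apply: (@le_trans _ _ (U (maxn i j) w - r (n (maxn i j)) / 8)).
    exact: (lo_incr w i (maxn i j) (leq_maxl _ _)).
  apply: (@le_trans _ _ (U (maxn i j) w + r (n (maxn i j)) / 8)).
    have := rn0 (maxn i j); lra.
  exact: (hi_decr w j (maxn i j) (leq_maxr _ _)).
pose Y w := sup (range (fun k => U k w - r (n k) / 8)).
have YU k w : `|Y w - U k w| <= r (n k) / 8.
  have h1 : U k w - r (n k) / 8 <= Y w.
    apply: ub_le_sup; last by exists k.
    by exists (U 0%N w + r (n 0%N) / 8) => _ [i _ <-]; exact: lo_hi.
  have h2 : Y w <= U k w + r (n k) / 8.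
    apply: ge_sup; first by exists (U 0%N w - r (n 0%N) / 8); exists 0%N.
    by move=> _ [i _ <-]; exact: lo_hi.
  by rewrite ler_norml; apply/andP; split; lra.
have n_gt k : (k < n k)%N.
  elim: k => [|k ih]; first exact: n0.
  apply: (leq_ltn_trans ih); rewrite -(ltr_nat R).
  rewrite -ltf_pV2 ?posrE//; apply: (le_lt_trans (nr k)).
  have := rn1 k; have := rn0 k; lra.
have UY w : U k w @[k --> \oo] --> Y w.
  apply/cvgrPdist_le => h h0; near=> k; apply: le_trans (YU k w) _.
  have k1 : k.+1%:R^-1 <= h.
    by apply: ltW; near: k; exact: near_infty_natSinv_lt (PosNum h0).
  apply: le_trans k1; apply: (@le_trans _ _ (n k)%:R^-1).
    by have := rn1 k; have := rn0 k; lra.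
  by rewrite lef_pV2 ?posrE// ler_nat.
have mY : measurable_fun setT Y.
  by apply: (@measurable_fun_cvg _ _ _ _ U) => // w _; exact: UY.
exists Y; split => //.
- move=> w m /= m1; exists (n m.+1) => /=.
    by rewrite (leq_trans (leqnSn m))// ltnW// n_gt.
  apply: (squeeze_V r_gt0 r_lt (n0 m.+1) (U01 m w)).
  apply: (le_lt_trans _ (_ : r (n m.+1) / 8 < r (n m.+1) / 4)).
    by have := YU m.+1 w; rewrite UE.
  have := rn0 m.+1; lra.
- apply: (rv_energy_limit (X := U)) => // k.
  apply: (@le_trans _ _ (rv_energy P (U k) + (stage_slack (sval (s k)))%:E)%E).
    by rewrite leeDl// lee_fin; case: (svalP (s k)) => _ _ _ _ /ltW.
  elim: k => [|k ih]; first by rewrite /U s_0.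
  by apply: le_trans ih; case: (ref k).
Unshelve. all: by end_near. Qed.

End Limit.

(** * Capacity of the uniform G_delta set *)

(** The relative error th is chosen against the energy of X, so that th times
    this energy is at most e / 2. *)
Lemma exists_smoothing d (T : measurableType d) (R : realType)
    (P : probability T R) (X : T -> R) (e : R) :
  measurable_fun setT X -> (forall w, 0 <= X w <= 1) -> 0 < e ->
  (rv_energy P X < +oo)%E ->
  exists (Z : T * measurableTypeR R -> R) (M : R),
    [/\ measurable_fun setT Z, forall p, 0 <= Z p <= 1, 0 <= M,
      frostman (P \x unif R)%E Z M &
      (rv_energy (P \x unif R)%E Z <= rv_energy P X + e%:E)%E].
Proof.
move=> mX X01 e0 Efin.
have E0 : (0 <= rv_energy P X)%E.
  by apply: integral_ge0 => w _; apply: integral_ge0 => z _; exact: pos_log_ge0.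
have Ef : rv_energy P X \is a fin_num by rewrite ge0_fin_numE.
pose E := fine (rv_energy P X).
have E0' : 0 <= E by exact: fine_ge0.
have s0 : 0 < e / 2 by rewrite divr_gt0.
pose A : R := 2 / (1 - expR (- (e / 2))).
have hA : 0 < 1 - expR (- (e / 2)) by rewrite subr_gt0 expR_lt1 oppr_lt0.
have A1 : 1 <= A.
  by rewrite /A ler_pdivlMr// mul1r; have := expR_gt0 (- (e / 2)); lra.
have A0 : 0 < A by lra.
pose th : R := e / 2 / (E + 1).
have th0 : 0 < th by rewrite divr_gt0//; lra.
pose c : R := 2 * 2 * ln 2 + ln A.
pose n := (Num.truncn (A * expR (c / th))).+1.
have mc : measurable_fun [set: measurableTypeR R]
    (@clamp R : measurableTypeR R -> R) by exact: measurable_clamp.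
have nc : c <= th * ln (n%:R / A).
  rewrite mulrC -ler_pdivrMr// -[leLHS]expRK ler_ln ?posrE ?expR_gt0//.
    by rewrite ler_pdivlMr// mulrC ltW// truncnS_gt.
  by rewrite divr_gt0.
exists (smooth X (@clamp R : measurableTypeR R -> R) n), (n%:R * 2).
split => //.
- exact: measurable_smooth.
- by move=> p; apply: smooth01 => //; exact: clamp01.
- by apply: smooth_frostman => //; exact: unif_clamp_frostman.
have hA2 : 2 <= A * (1 - expR (- (e / 2))) by rewrite /A mulfVK// gt_eqF.
apply: (le_trans (smooth_energy P mX mc X01 (@clamp01 R) (isT : (0 < n)%N)
  _ (@unif_clamp_frostman R) A1 (ltW s0) (ltW th0) hA2 nc)) => //.
rewrite -(fineK Ef) -/E -EFinM -!EFinD lee_fin mulrDl mul1r.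
have : th * E <= e / 2.
  rewrite /th mulrAC ler_pdivrMr; last by lra.
  by rewrite ler_pM2l//; lra.
lra.
Qed.

Lemma Gdelta_unit (R : realType) (r : nat -> R)
  (r_lt : forall n : nat, (1 <= n)%N -> r n < 1 / n%:R) :
  uniform_Gdelta r `<=` `[0, 1].
Proof.
move=> x /(_ 1%N (leqnn 1)) [n /= n1 Vx].
by rewrite /= in_itv /=; exact: (V01 r_lt n1 Vx).
Qed.

Lemma measurable_Gdelta (R : realType) (r : nat -> R) :
  measurable (uniform_Gdelta r).
Proof.
apply: bigcap_measurable => [|m _]; first by exists 1%N.
apply: bigcup_measurable => n _; apply: bigcup_measurable => j _.
exact: measurable_itv.
Qed.

Lemma prob_on_subset (R : realType) (A B : set R) (mu : probability (borelC R) R) :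
  measurable A -> measurable B -> A `<=` B ->
  prob_on (toC A) mu -> prob_on (toC B) mu.
Proof.
move=> mA mB AB muA; apply/eqP; rewrite -measure_le0 -[leRHS]muA.
apply: le_measure; rewrite ?inE.
- by apply: measurableC; exact: measurable_toC.
- by apply: measurableC; exact: measurable_toC.
- by apply: subsetC => _ [x Ax <-]; exists x => //; exact: AB.
Qed.

Theorem theorem1p1 (R : realType) (r : nat -> R)
  (r_decr : forall m n : nat, (1 <= m)%N -> (m <= n)%N -> r n <= r m)
  (r_gt0 : forall n : nat, (1 <= n)%N -> 0 < r n)
  (r_cvg0 : r n @[n --> \oo] --> 0)
  (r_lt : forall n : nat, (1 <= n)%N -> r n < 1 / n%:R)
  (r_log : (fun n : nat => `|ln (r n)|) =o_\oo (fun n : nat => n%:R : R)) :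
  Cap (toC (uniform_Gdelta r)) = Cap (toC (`[0, 1]%classic : set R)).
Proof.
rewrite /Cap; congr (expeR (- _)%E).
set S := uniform_Gdelta r; apply/eqP; rewrite eq_le; apply/andP; split.
  apply/ereal_infP => _ [mu mu01 <-].
  have [->|Efin] := eqVneq (energy mu) +oo%E; first exact: leey.
  apply/lee_addgt0Pr => e e0; have e20 : 0 < e / 2 by rewrite divr_gt0.
  have mX := @measurable_clampRe R; have X01 := @clampRe01 R.
  rewrite energy_unit// in Efin *.
  have {}Efin : (rv_energy mu (@clampRe R) < +oo)%E by rewrite ltey.
  have [Z [M [mZ Z01 M0 fZ ZE]]] := exists_smoothing mX X01 e20 Efin.
  have [Y [mY YS YE]] :=
    exists_Gdelta_variable r_gt0 r_lt r_log mZ Z01 M0 fZ e20.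
  have Y01 p : 0 <= Y p <= 1.
    by have := Gdelta_unit r_lt (YS p); rewrite /= in_itv.
  have [nu nuS nuE] := exists_energy_law ((mu \x unif R)%E) mY Y01 YS.
  apply: (@le_trans _ _ (energy nu)); first by apply: ereal_inf_lbound; exists nu.
  rewrite nuE; apply: (le_trans YE); apply: (le_trans (leeD2r _ ZE)).
  by rewrite -addeA -EFinD -splitr.
apply: ereal_inf_le_tmp => _ [mu muS <-]; exists mu => //.
apply: prob_on_subset muS; [exact: measurable_Gdelta|exact: measurable_itv|].
exact: Gdelta_unit.
Qed.
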